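(* Let $\tau:E\to M$ be an affine bundle modelled on a vector bundle $V\to M$, with bidual vector bundle $\tilde E\to M$, and suppose a (vector) Lie algebroid structure on $\tilde E$ is given, with exterior differential $d$. Let $e^0$ be the 1-form on $\tilde E$ given by the section of $E^\dagger=\tilde E^*$ whose value at each $m\in M$ is the constant function $1$ on $E_m$. Then the Lie algebroid structure on $\tilde E$ restricts to a Lie algebroid structure on the affine bundle $E$ if and only if $de^0=0$.
   Context: All bundles are smooth of finite rank. For $m\in M$, $E_m^\dagger=\mathrm{Aff}(E_m,\mathbb{R})$ is the vector space of affine functions on $E_m$; these form the vector bundle $E^\dagger\to M$, and $\tilde E=(E^\dagger)^*$. For $\varphi\in E^\dagger_m$ let $\boldsymbol{\varphi}\in V_m^*$ be its linear part. The canonical immersion is $i:E\to\tilde E$, $i(a)(\varphi)=\varphi(a)$, with linear part $\boldsymbol{i}:V\to\tilde E$, $\boldsymbol{i}(\boldsymbol{v})(\varphi)=\boldsymbol{\varphi}(\boldsymbol{v})$. A Lie algebroid structure on $\tilde E$ is said to restrict to a Lie algebroid structure on the affine bundle $E$ if the bracket of any two sections of $\tilde E$ lying in the image of $i$ is a section lying in the image of $\boldsymbol{i}$. A $k$-form on $\tilde E$ is a section of $\Lambda^k\tilde E^*$, and $d$ is the usual Lie algebroid differential; on a 1-form $\theta$ it is $d\theta(\zeta_1,\zeta_2)=\tilde\rho(\zeta_1)\langle\theta,\zeta_2\rangle-\tilde\rho(\zeta_2)\langle\theta,\zeta_1\rangle-\langle\theta,[\zeta_1,\zeta_2]\rangle$,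 where $\tilde\rho:\tilde E\to TM$ is the anchor. *)

(* Defs.v *)
From HB Require Import structures.
From mathcomp Require Import all_boot all_order all_algebra.
From mathcomp Require Import all_classical all_reals all_analysis.
From mathcomp Require Import ring.
Set Implicit Arguments.
Unset Strict Implicit.
Unset Printing Implicit Defensive.
Import Order.TTheory GRing.Theory Num.Theory.
Import numFieldNormedType.Exports.
Local Open Scope classical_set_scope.
Local Open Scope ring_scope.

Section Smooth.
Variables (R : realType) (V : normedModType R).
Implicit Types (f g : V -> R) (U W : set V).

(* Only meant for open [U]: the pointwise conditions are those of the ambient
   space. *)
Fixpoint Ck (k : nat) (U : set V) (f : V -> R) : Prop :=
  if k is k'.+1 then
    (forall x, U x -> differentiable f x) /\ (forall v, Ck k' U ('D_v f))
  else forall x, U x -> {for x, continuous f}.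

Definition Cinfty (U : set V) (f : V -> R) : Prop := forall k, Ck k U f.

Lemma Ck_glue (I : Type) (W : I -> set V) k U f :
  (forall x, U x -> exists i, W i x) -> (forall i, Ck k (W i) f) -> Ck k U f.
Proof.
elim: k f => [|k IH] f cov Wf /=.
  by move=> x /cov[i Wx]; exact: (Wf i).
split; first by move=> x /cov[i Wx]; exact: (Wf i).1.
by move=> v; apply: IH => // i; exact: (Wf i).2.
Qed.

Lemma Ck_sub k U W f : W `<=` U -> Ck k U f -> Ck k W f.
Proof.
by move=> WU Uf; apply: (@Ck_glue unit (fun=> U)) => // x /WU; exists tt.
Qed.

Lemma Ck_cont k U f : Ck k U f -> Ck 0 U f.
Proof.
by case: k => // k [df _] x Ux; apply: differentiable_continuous; exact: df.
Qed.

Lemma Ck_pred k U f : Ck k.+1 U f -> Ck k U f.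
Proof.
elim: k f => [|k IH] f; first exact: Ck_cont.
by move=> [df Df]; split=> // v; apply: IH.
Qed.

Lemma near_eq_differentiable f g (x : V) :
  (\near x, f x = g x) -> differentiable f x -> differentiable g x.
Proof.
move=> fg /diff_locallyP[dc /eqaddoP fE].
have gE : g \o shift x = cst (g x) + 'd f x +o_ 0 id.
  apply/eqaddoP => e e0; have := fE e e0.
  have fg0 : \forall y \near (0 : V), f (y + x) = g (y + x).
    by move: fg; rewrite (near_shift 0) => fg; apply: filterS fg => y /=; rewrite subr0.
  apply: filterS2 fg0 => y fgy; rewrite !fctE /= in fgy *.
  by rewrite fgy (nbhs_singleton fg).
by apply/diff_locallyP; rewrite (diff_unique dc gE).
Qed.

Lemma Ck_eq k U f g : open U -> (forall x, U x -> f x = g x) ->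
  Ck k U f -> Ck k U g.
Proof.
move=> oU; elim: k f g => [|k IH] f g fg.
  move=> fC x Ux; have fgx : \near x, f x = g x.
    by apply: filterS (open_nbhs_nbhs (conj oU Ux)) => y /fg.
  have := fC x Ux; rewrite /prop_for /continuous_at -(fg x Ux).
  exact: cvg_trans (near_eq_cvg fgx).
move=> [df Df]; split=> [x Ux|v].
  apply: near_eq_differentiable (df x Ux).
  by apply: filterS (open_nbhs_nbhs (conj oU Ux)) => y /fg.
apply: IH (Df v) => x Ux; apply: near_eq_derive.
by apply: filterS (open_nbhs_nbhs (conj oU Ux)) => y /fg.
Qed.

Lemma Ck_cst k U c : Ck k U (cst c).
Proof.
elim: k c => [|k IH] c /=; first by move=> x _; exact: cst_continuous.
split=> // v; suff -> : 'D_v (cst c : V -> R) = cst 0 by exact: IH.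
by apply/funext => x; rewrite derive_cst.
Qed.

Lemma CkD k U f g : open U -> Ck k U f -> Ck k U g -> Ck k U (f \+ g).
Proof.
move=> oU; elim: k f g => [|k IH] f g; first by move=> fC gC x Ux; apply: cvgD; [exact: fC|exact: gC].
move=> [df Df] [dg Dg]; split=> [x Ux|v].
  by apply: differentiableD; [exact: df|exact: dg].
apply: (Ck_eq oU) (IH _ _ (Df v) (Dg v)) => x Ux /=.
by rewrite deriveD//; apply: diff_derivable; [exact: df|exact: dg].
Qed.

Lemma CkM k U f g : open U -> Ck k U f -> Ck k U g -> Ck k U (f \* g).
Proof.
move=> oU; elim: k f g => [|k IH] f g; first by move=> fC gC x Ux; apply: cvgM; [exact: fC|exact: gC].
move=> fC gC; have [df Df] := fC; have [dg Dg] := gC; split=> [x Ux|v].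
  by apply: differentiableM; [exact: df|exact: dg].
apply: (Ck_eq oU) (CkD oU (IH _ _ (Ck_pred fC) (Dg v))
  (IH _ _ (Ck_pred gC) (Df v))) => x Ux /=.
by rewrite deriveM//; apply: diff_derivable; [exact: df|exact: dg].
Qed.

End Smooth.

Record manifold (R : realType) (n : nat) := Manifold {
  mcarrier :> topologicalType ;
  mchart : Type ;
  mdom : mchart -> set mcarrier ;
  mcod : mchart -> set 'rV[R]_n ;
  mphi : mchart -> mcarrier -> 'rV[R]_n ;
  mpsi : mchart -> 'rV[R]_n -> mcarrier ;
  mdom_open : forall c, open (mdom c) ;
  mcod_open : forall c, open (mcod c) ;
  mdom_cover : forall m, exists c, mdom c m ;
  mphi_cod : forall c m, mdom c m -> mcod c (mphi c m) ;
  mpsi_dom : forall c x, mcod c x -> mdom c (mpsi c x) ;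
  mphiK : forall c m, mdom c m -> mpsi c (mphi c m) = m ;
  mpsiK : forall c x, mcod c x -> mphi c (mpsi c x) = x ;
  mphi_cont : forall c m, mdom c m -> {for m, continuous (mphi c)} ;
  mpsi_cont : forall c x, mcod c x -> {for x, continuous (mpsi c)} ;
  mtransition : forall c d i,
    Cinfty (mcod c `&` mpsi c @^-1` mdom d) (fun x => mphi d (mpsi c x) 0 i) ;
  mhausdorff : hausdorff_space mcarrier ;
  msecond_countable : @second_countable mcarrier }.

Section SmoothOn.
Variables (R : realType) (n : nat) (M : manifold R n).
Implicit Types (f g : M -> R) (U W : set M).

(* Only meant for open [W]. *)
Definition smooth_on (W : set M) (f : M -> R) : Prop :=
  forall c : mchart M,
    Cinfty (mcod c `&` mpsi c @^-1` W) (f \o mpsi c).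

Lemma open_chart_preimage (c : mchart M) W : open W ->
  open (mcod c `&` mpsi c @^-1` W).
Proof.
move=> oW; rewrite openE => x [cx Wx].
have Cx : nbhs x (mcod c) by apply: open_nbhs_nbhs; split => //; exact: mcod_open.
apply: filterI Cx _; apply: (mpsi_cont cx).
by apply: open_nbhs_nbhs; split.
Qed.

Lemma smooth_on_glue (I : Type) (W : I -> set M) U f :
  (forall m, U m -> exists i, W i m) -> (forall i, smooth_on (W i) f) ->
  smooth_on U f.
Proof.
move=> cov Wf c k.
apply: (@Ck_glue _ _ I (fun i => mcod c `&` mpsi c @^-1` (W i))).
  by move=> x [cx /cov[i Wx]]; exists i.
by move=> i; exact: Wf.
Qed.

Lemma smooth_on_sub U W f : W `<=` U -> smooth_on U f -> smooth_on W f.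
Proof.
by move=> WU Uf c k; apply: Ck_sub (Uf c k) => x [? /WU ?]; split.
Qed.

Lemma smooth_on_eq U f g : open U -> (forall m, U m -> f m = g m) ->
  smooth_on U f -> smooth_on U g.
Proof.
move=> oU fg Uf c k; apply: Ck_eq (Uf c k).
  exact: open_chart_preimage.
by move=> x [_ Ux] /=; exact: fg.
Qed.

Lemma smooth_on_cst U a : smooth_on U (cst a).
Proof. by move=> c k; exact: Ck_cst. Qed.

Lemma smooth_onD U f g : open U ->
  smooth_on U f -> smooth_on U g -> smooth_on U (fun m => f m + g m).
Proof.
move=> oU Uf Ug c k.
by apply: CkD (Uf c k) (Ug c k); exact: open_chart_preimage.
Qed.

Lemma smooth_onM U f g : open U ->
  smooth_on U f -> smooth_on U g -> smooth_on U (fun m => f m * g m).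
Proof.
move=> oU Uf Ug c k.
by apply: CkM (Uf c k) (Ug c k); exact: open_chart_preimage.
Qed.

Lemma smooth_onZ U a f : open U ->
  smooth_on U f -> smooth_on U (fun m => a * f m).
Proof. by move=> oU; apply: smooth_onM => //; exact: smooth_on_cst. Qed.

Lemma smooth_onN U f : open U ->
  smooth_on U f -> smooth_on U (fun m => - f m).
Proof.
move=> oU /(smooth_onZ (-1) oU).
by congr smooth_on; apply/funext => m; rewrite mulN1r.
Qed.

Lemma smooth_onB U f g : open U ->
  smooth_on U f -> smooth_on U g -> smooth_on U (fun m => f m - g m).
Proof. by move=> oU Uf Ug; apply: smooth_onD => //; exact: smooth_onN. Qed.

Lemma smooth_on_sum U (I : Type) (s : seq I) (F : I -> M -> R) : open U ->
  (forall i, smooth_on U (F i)) -> smooth_on U (fun m => \sum_(i <- s) F i m).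
Proof.
move=> oU UF; elim: s => [|i s IH].
  rewrite (_ : (fun=> _) = cst 0); first exact: smooth_on_cst.
  by apply/funext => m; rewrite big_nil.
rewrite (_ : (fun=> _) = (fun m => F i m + \sum_(j <- s) F j m)).
  exact: smooth_onD.
by apply/funext => m; rewrite big_cons.
Qed.

Definition smooth_pred : {pred (M -> R)} := [pred f | `[< smooth_on setT f >]].

Lemma smooth_predP f : f \in smooth_pred <-> smooth_on setT f.
Proof. by split=> /asboolP. Qed.

Lemma smooth_subring_closed : subring_closed smooth_pred.
Proof.
split=> [|f g|f g]; first exact: (smooth_predP _).2 (@smooth_on_cst setT 1).
  move=> /smooth_predP sf /smooth_predP sg; apply/smooth_predP.
  exact: smooth_onB openT sf sg.
move=> /smooth_predP sf /smooth_predP sg; apply/smooth_predP.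
exact: smooth_onM openT sf sg.
Qed.
HB.instance Definition _ :=
  GRing.isSubringClosed.Build (M -> R) smooth_pred smooth_subring_closed.

Record sfun := SFun { sfun_val :> M -> R ; sfunP : sfun_val \in smooth_pred }.
HB.instance Definition _ := [isSub for sfun_val].
HB.instance Definition _ := [Choice of sfun by <:].
HB.instance Definition _ :=
  GRing.SubChoice_isSubComPzRing.Build (M -> R) smooth_pred sfun
    smooth_subring_closed.

Definition sfun_cst (a : R) : sfun :=
  SFun ((smooth_predP (cst a)).2 (@smooth_on_cst setT a)).

End SmoothOn.

Notation "''Coo' ( M )" := (sfun M) (at level 8, format "''Coo' ( M )").

(* Tangent vectors at [m] are the derivations of 'Coo(M) at [m]. *)
Section Tangent.
Variables (R : realType) (n : nat) (M : manifold R n) (m : M).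

Definition is_derivation (D : 'Coo(M) -> R^o) : Prop :=
  [/\ forall f g, D (f + g) = D f + D g,
      forall a f, D (sfun_cst M a * f) = a * D f &
      forall f g, D (f * g) = f m * D g + g m * D f].

Definition derivation_pred : {pred ('Coo(M) -> R^o)} :=
  [pred D | `[< is_derivation D >]].

Lemma derivation_predP D : D \in derivation_pred <-> is_derivation D.
Proof. by split=> /asboolP. Qed.

Lemma derivation_submod_closed : submod_closed derivation_pred.
Proof.
split.
  apply/derivation_predP; split=> [f g|a f|f g].
  - exact/esym/addr0.
  - exact/esym/mulr0.
  - by rewrite -[LHS]/0 -[X in _ = f m * X + g m * X]/0 !mulr0 addr0.
move=> a D D' /derivation_predP[D1 D2 D3] /derivation_predP[E1 E2 E3].
apply/derivation_predP.
have E f : (a *: D + D') f = a * D f + D' f by [].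
split=> [f g|b f|f g]; rewrite !E.
- by rewrite D1 E1 mulrDr addrACA.
- by rewrite D2 E2 mulrDr mulrCA.
- by rewrite D3 E3 !mulrDr addrACA; congr (_ + _ + (_ + _)); rewrite mulrCA.
Qed.
HB.instance Definition _ :=
  GRing.isSubmodClosed.Build R ('Coo(M) -> R^o) derivation_pred
    derivation_submod_closed.

Record tangent := Tangent {
  tangent_val :> 'Coo(M) -> R^o ; tangentP : tangent_val \in derivation_pred }.
HB.instance Definition _ := [isSub for tangent_val].
HB.instance Definition _ := [Choice of tangent by <:].
HB.instance Definition _ := [SubChoice_isSubLmodule of tangent by <:].

End Tangent.

(* A vector bundle of rank [r] is given by its fibres and local
   trivializations with smooth transition functions; the smooth structure of
   the total space is the one making the trivializations diffeomorphisms.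
   [vtriv j m] and [vinv j m] are only meaningful for [m] in [vdom j]. *)
Record vbundle (R : realType) (n : nat) (M : manifold R n) (r : nat) := VBundle {
  vfib :> M -> lmodType R ;
  vidx : Type ;
  vdom : vidx -> set M ;
  vtriv : vidx -> forall m, {linear vfib m -> 'rV[R]_r} ;
  vinv : vidx -> forall m, 'rV[R]_r -> vfib m ;
  vdom_open : forall j, open (vdom j) ;
  vdom_cover : forall m, exists j, vdom j m ;
  vtrivK : forall j m, vdom j m -> cancel (vtriv j m) (vinv j m) ;
  vinvK : forall j m, vdom j m -> cancel (vinv j m) (vtriv j m) ;
  vtransition : forall j k x i,
    smooth_on (vdom j `&` vdom k) (fun m => vtriv k m (vinv j m x) 0 i) }.
Arguments vdom {R n M r} A j : rename.
Arguments vtriv {R n M r} A j m : rename.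
Arguments vinv {R n M r} A j m x : rename.
Arguments vdom_open {R n M r} A j : rename.
Arguments vdom_cover {R n M r} A m : rename.

Section Sections.
Variables (R : realType) (n : nat) (M : manifold R n) (r : nat).
Variable A : vbundle M r.

Definition pre_section := forall m : M, A m.
Identity Coercion fun_of_pre_section : pre_section >-> Funclass.
HB.instance Definition _ := gen_eqMixin pre_section.
HB.instance Definition _ := gen_choiceMixin pre_section.

Let padd (s t : pre_section) : pre_section := fun m => s m + t m.
Let popp (s : pre_section) : pre_section := fun m => - s m.
Let pzero : pre_section := fun=> 0.
Let pscale (f : 'Coo(M)) (s : pre_section) : pre_section := fun m => f m *: s m.

Let paddA : associative padd.
Proof. by move=> s t u; apply: functional_extensionality_dep => m; exact: addrA. Qed.
Let paddC : commutative padd.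
Proof. by move=> s t; apply: functional_extensionality_dep => m; exact: addrC. Qed.
Let padd0 : left_id pzero padd.
Proof. by move=> s; apply: functional_extensionality_dep => m; exact: add0r. Qed.
Let paddN : left_inverse pzero popp padd.
Proof. by move=> s; apply: functional_extensionality_dep => m; exact: addNr. Qed.
HB.instance Definition _ :=
  GRing.isZmodule.Build pre_section paddA paddC padd0 paddN.

Let pscaleA f g s : pscale f (pscale g s) = pscale (f * g) s.
Proof. by apply: functional_extensionality_dep => m; exact: scalerA. Qed.
Let pscale1 : left_id 1 pscale.
Proof. by move=> s; apply: functional_extensionality_dep => m; exact: scale1r. Qed.
Let pscaleDr : right_distributive pscale +%R.
Proof. by move=> f s t; apply: functional_extensionality_dep => m; exact: scalerDr. Qed.
Let pscaleDl s : {morph pscale^~ s : f g / f + g}.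
Proof. by move=> f g; apply: functional_extensionality_dep => m; exact: scalerDl. Qed.
HB.instance Definition _ := GRing.Zmodule_isLmodule.Build 'Coo(M) pre_section
  pscaleA pscale1 pscaleDr pscaleDl.

Definition smooth_section (s : pre_section) : Prop :=
  forall j i, smooth_on (vdom A j) (fun m => vtriv A j m (s m) 0 i).

Definition section_pred : {pred pre_section} := [pred s | `[< smooth_section s >]].

Lemma section_predP s : s \in section_pred <-> smooth_section s.
Proof. by split=> /asboolP. Qed.

Lemma section_submod_closed : submod_closed section_pred.
Proof.
split.
  apply/section_predP => j i; rewrite (_ : (fun=> _) = cst 0).
    exact: smooth_on_cst.
  by apply/funext => m; rewrite linear0 mxE.
move=> f s t /section_predP sS /section_predP tS; apply/section_predP => j i.
rewrite (_ : (fun=> _) = fun m =>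
    f m * vtriv A j m (s m) 0 i + vtriv A j m (t m) 0 i).
  apply: smooth_onD (tS j i); first exact: vdom_open.
  apply: smooth_onM (sS j i); first exact: vdom_open.
  by apply: (@smooth_on_sub _ _ _ setT) => //; apply/smooth_predP; exact: sfunP.
apply/funext => m.
by rewrite -[(f *: s + t) m]/(f m *: s m + t m) linearP !mxE.
Qed.
HB.instance Definition _ :=
  GRing.isSubmodClosed.Build 'Coo(M) pre_section section_pred section_submod_closed.

Record vsection := VSection {
  section_val :> pre_section ; sectionP : section_val \in section_pred }.
HB.instance Definition _ := [isSub for section_val].
HB.instance Definition _ := [Choice of vsection by <:].
HB.instance Definition _ := [SubChoice_isSubLmodule of vsection by <:].

End Sections.

Notation "''Gamma' ( A )" := (vsection A) (at level 8, format "''Gamma' ( A )").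

Section Dual.
Variables (R : realType) (V : lmodType R).

Definition dual_pred : {pred (V -> R^o)} := [pred l | `[< linear l >]].

Lemma dual_predP l : l \in dual_pred <-> linear l.
Proof. by split=> /asboolP. Qed.

Lemma dual_submod_closed : submod_closed dual_pred.
Proof.
split; first by apply/dual_predP => a u v; rewrite -[LHS]/0 scaler0 addr0.
move=> a l l' /dual_predP lL /dual_predP lL'; apply/dual_predP => b u v.
have E w : (a *: l + l') w = a *: l w + l' w by [].
by rewrite !E lL lL' !scalerDr addrACA !scalerA mulrC.
Qed.
HB.instance Definition _ :=
  GRing.isSubmodClosed.Build R (V -> R^o) dual_pred dual_submod_closed.

Record dual := Dual { dual_val :> V -> R^o ; dualP : dual_val \in dual_pred }.
HB.instance Definition _ := [isSub for dual_val].
HB.instance Definition _ := [Choice of dual by <:].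
HB.instance Definition _ := [SubChoice_isSubLmodule of dual by <:].

Lemma dual_linear (l : dual) : linear l.
Proof. by apply/dual_predP; exact: dualP. Qed.
HB.instance Definition _ (l : dual) :=
  GRing.isLinear.Build R V R^o *%R (dual_val l) (dual_linear l).

Lemma dual_eq (l l' : dual) : (forall v, l v = l' v) -> l = l'.
Proof. by move=> ll'; apply: val_inj; apply/funext => v; exact: ll'. Qed.

Definition mkdual (l : V -> R^o) (lL : linear l) : dual :=
  Dual ((dual_predP l).2 lL).

End Dual.

Section DualBundle.
Variables (R : realType) (n : nat) (M : manifold R n) (r : nat).
Variable A : vbundle M r.

Lemma vinv_linear j m : vdom A j m -> linear (vinv A j m).
Proof.
move=> jm a x y; apply: (can_inj (vtrivK jm)).
by rewrite linearP !vinvK.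
Qed.

Lemma vinv_expand j m (v : A m) : vdom A j m ->
  v = \sum_i vtriv A j m v 0 i *: vinv A j m (delta_mx 0 i).
Proof.
move=> jm; apply: (can_inj (vtrivK jm)); rewrite linear_sum/=.
rewrite {1}[vtriv A j m v]row_sum_delta; apply: eq_bigr => i _.
by rewrite linearZ/= vinvK.
Qed.

Definition dual_triv_fun j m (l : dual (A m)) : 'rV[R]_r :=
  \row_i l (vinv A j m (delta_mx 0 i)).
Lemma dual_triv_linear j m : linear (@dual_triv_fun j m).
Proof. by move=> a l l'; apply/rowP => i; rewrite !mxE. Qed.
HB.instance Definition _ j m := GRing.isLinear.Build R (dual (A m)) 'rV[R]_r _
  (@dual_triv_fun j m) (@dual_triv_linear j m).
Definition dual_triv j m : {linear dual (A m) -> 'rV[R]_r} := @dual_triv_fun j m.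

Lemma dual_inv_linear j m (x : 'rV[R]_r) :
  linear (fun v : A m => \sum_i x 0 i * vtriv A j m v 0 i : R^o).
Proof.
move=> a u v; rewrite scaler_sumr -big_split/=; apply: eq_bigr => i _.
by rewrite linearP !mxE mulrDr /GRing.scale/= mulrCA.
Qed.
Definition dual_inv j m (x : 'rV[R]_r) : dual (A m) := mkdual (@dual_inv_linear j m x).

Lemma dual_trivK j m : vdom A j m -> cancel (dual_triv j m) (@dual_inv j m).
Proof.
move=> jm l; apply: dual_eq => v /=; rewrite [in RHS](vinv_expand v jm).
rewrite linear_sum/=; apply: eq_bigr => i _.
by rewrite linearZ/= mxE mulrC.
Qed.

Lemma dual_invK j m : vdom A j m -> cancel (@dual_inv j m) (dual_triv j m).
Proof.
move=> jm x; apply/rowP => i; rewrite mxE.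
rewrite -[LHS]/(\sum_k x 0 k * vtriv A j m (vinv A j m (delta_mx 0 i)) 0 k).
rewrite vinvK// (bigD1 i)//= mxE !eqxx mulr1 big1 ?addr0// => k ki.
by rewrite mxE (negbTE ki) andbF mulr0.
Qed.

Lemma dual_transition j k x i : smooth_on (vdom A j `&` vdom A k)
  (fun m => dual_triv k m (@dual_inv j m x) 0 i).
Proof.
rewrite (_ : (fun=> _) = fun m =>
  \sum_l x 0 l * vtriv A j m (vinv A k m (delta_mx 0 i)) 0 l); last first.
  by apply/funext => m; rewrite mxE.
have oU : open (vdom A j `&` vdom A k) by apply: openI; exact: vdom_open.
apply: smooth_on_sum => // l; apply: smooth_onZ => //.
by rewrite setIC; exact: vtransition.
Qed.

Definition dual_bundle : vbundle M r :=
  @VBundle R n M r (fun m => dual (A m)) (vidx A) (vdom A)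
    dual_triv dual_inv (vdom_open A) (vdom_cover A)
    dual_trivK dual_invK dual_transition.

Lemma pairing_smooth (t : 'Gamma(dual_bundle)) (s : 'Gamma(A)) :
  (fun m => t m (s m)) \in smooth_pred (M := M).
Proof.
apply/smooth_predP; apply: (@smooth_on_glue _ _ _ (vidx A) (vdom A)).
  by move=> m _; exact: vdom_cover.
move=> j; pose F m := \sum_i
  vtriv dual_bundle j m (t m) 0 i * vtriv A j m (s m) 0 i.
apply: (@smooth_on_eq _ _ _ _ F); first exact: vdom_open.
  move=> m jm; rewrite /F [in RHS](vinv_expand (s m) jm) linear_sum/=.
  by apply: eq_bigr => i _; rewrite linearZ/= mxE mulrC.
have [/section_predP tS /section_predP sS] := (sectionP t, sectionP s).
apply: smooth_on_sum; first exact: vdom_open.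
by move=> i; apply: smooth_onM (tS j i) (sS j i); exact: vdom_open.
Qed.

Definition pairing (t : 'Gamma(dual_bundle)) (s : 'Gamma(A)) : 'Coo(M) :=
  SFun (pairing_smooth t s).

End DualBundle.

Section DoubleDual.
Variables (R : realType) (n : nat) (M : manifold R n) (r : nat).
Variable A : vbundle M r.

Definition evaluation (V : lmodType R) (v : V) : dual (dual V) :=
  @mkdual R (dual V) (fun l => l v) (fun a l l' => erefl).

Lemma bidual_smooth (s : 'Gamma(A)) :
  ((fun m => evaluation (s m)) : pre_section (dual_bundle (dual_bundle A)))
    \in section_pred (A := dual_bundle (dual_bundle A)).
Proof.
have /section_predP sS := sectionP s.
apply/section_predP => j i; apply: (@smooth_on_eq _ _ _ _ _ _ _ _ (sS j i)).
  exact: vdom_open.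
move=> m jm; rewrite !mxE /= (bigD1 i)//= mxE !eqxx mul1r.
rewrite big1 ?addr0// => k ki; by rewrite mxE (negbTE ki) andbF mul0r.
Qed.

(* The identification of [A] with its double dual. *)
Definition bidual_section (s : 'Gamma(A)) : 'Gamma(dual_bundle (dual_bundle A)) :=
  VSection (bidual_smooth s).

End DoubleDual.

Record affspace (R : realType) (V : lmodType R) := AffSpace {
  apoint :> Type ;
  vadd : apoint -> V -> apoint ;
  apoint_inhabited : inhabited apoint ;
  vadd0 : forall a, vadd a 0 = a ;
  vaddA : forall a u v, vadd (vadd a u) v = vadd a (u + v) ;
  vadd_simply_transitive : forall a b, exists! v, vadd a v = b }.

Notation "a +: v" := (vadd a v) (at level 50, left associativity).

Section Aff.
Variables (R : realType) (V : lmodType R) (E : affspace V).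

Definition has_linear_part (p : E -> R^o) (l : dual V) : Prop :=
  forall a v, p (a +: v) = p a + l v.

Definition aff_pred : {pred (E -> R^o)} :=
  [pred p | `[< exists l, has_linear_part p l >]].

Lemma aff_predP p : p \in aff_pred <-> exists l, has_linear_part p l.
Proof. by split=> /asboolP. Qed.

Lemma aff_submod_closed : submod_closed aff_pred.
Proof.
split; first by apply/aff_predP; exists 0 => a v; rewrite -[LHS]/0 -[RHS]/(0 + 0) addr0.
move=> b p q /aff_predP[l pl] /aff_predP[l' ql]; apply/aff_predP.
exists (b *: l + l') => a v.
have E1 x : (b *: p + q) x = b *: p x + q x by [].
have E2 x : (b *: l + l') x = b *: l x + l' x by [].
by rewrite !E1 E2 pl ql scalerDr addrACA.
Qed.
HB.instance Definition _ :=
  GRing.isSubmodClosed.Build R (E -> R^o) aff_pred aff_submod_closed.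

Record aff := Aff { aff_val :> E -> R^o ; affP : aff_val \in aff_pred }.
HB.instance Definition _ := [isSub for aff_val].
HB.instance Definition _ := [Choice of aff by <:].
HB.instance Definition _ := [SubChoice_isSubLmodule of aff by <:].

Lemma aff_eq (p q : aff) : (forall a, p a = q a) -> p = q.
Proof. by move=> pq; apply: val_inj; apply/funext => a; exact: pq. Qed.

Definition linear_part (p : aff) : dual V := projT1 (cid ((aff_predP p).1 (affP p))).

Lemma linear_partP (p : aff) a v : p (a +: v) = p a + linear_part p v.
Proof. by rewrite /linear_part; case: cid => l /= ->. Qed.

Lemma aff_cst_proof (c : R) : (cst c : E -> R^o) \in aff_pred.
Proof. by apply/aff_predP; exists 0 => a v /=; rewrite -[X in _ + X]/0 addr0. Qed.
Definition aff_cst (c : R) : aff := Aff (aff_cst_proof c).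

Definition immersion (a : E) : dual aff :=
  @mkdual R aff (fun p => p a) (fun b p q => erefl).

Lemma linear_part_linear v : linear (fun p : aff => linear_part p v).
Proof.
move=> b p q; have [a] := apoint_inhabited E.
have E1 x : (b *: p + q) x = b *: p x + q x by [].
apply: (addrI ((b *: p + q) a)).
by rewrite -linear_partP !E1 !linear_partP scalerDr addrACA.
Qed.
Definition linear_immersion (v : V) : dual aff := mkdual (linear_part_linear v).

End Aff.

(* [atriv j m] is an affine isomorphism from the fibre onto R^r with inverse
   [ainv j m] and linear part [alin j m] when [m] is in [adom j]. The linear
   parts are required to be smooth with respect to [V]; their inverses then are
   by Cramer's rule. Outside [adom j], [atriv j m] is only an affine map, which
   is no restriction since it may be constant. *)
Record affbundle (R : realType) (n : nat) (M : manifold R n) (r : nat)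
    (V : vbundle M r) := AffBundle {
  afib :> forall m, affspace (V m) ;
  aidx : Type ;
  adom : aidx -> set M ;
  atriv : aidx -> forall m, afib m -> 'rV[R]_r ;
  alin : aidx -> forall m, {linear V m -> 'rV[R]_r} ;
  ainv : aidx -> forall m, 'rV[R]_r -> afib m ;
  adom_open : forall j, open (adom j) ;
  adom_cover : forall m, exists j, adom j m ;
  atrivD : forall j m (a : afib m) v, atriv j (a +: v) = atriv j a + alin j m v ;
  atrivK : forall j m, adom j m -> cancel (@atriv j m) (ainv j m) ;
  ainvK : forall j m, adom j m -> cancel (ainv j m) (@atriv j m) ;
  atransition : forall j k x i,
    smooth_on (adom j `&` adom k) (fun m => atriv k (ainv j m x) 0 i) ;
  alin_smooth : forall j k x i,
    smooth_on (adom j `&` vdom V k) (fun m => alin j m (vinv V k m x) 0 i) }.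
Arguments adom {R n M r V} E j : rename.
Arguments atriv {R n M r V} E j m a : rename.
Arguments alin {R n M r V} E j m : rename.
Arguments ainv {R n M r V} E j m x : rename.
Arguments adom_open {R n M r V} E j : rename.
Arguments adom_cover {R n M r V} E m : rename.

(* The coordinates of an affine function in a trivialization are its value at
   the origin followed by those of its linear part. *)
Section AffFunctions.
Variables (R : realType) (n : nat) (M : manifold R n) (r : nat).
Variables (V : vbundle M r) (E : affbundle V).

Definition aff_triv_fun j m (p : aff (E m)) : 'rV[R]_(1 + r) :=
  row_mx (p (ainv E j m 0))%:M
    (\row_i (p (ainv E j m (delta_mx 0 i)) - p (ainv E j m 0))).
Lemma aff_triv_linear j m : linear (@aff_triv_fun j m).
Proof.
move=> a p q; rewrite /aff_triv_fun scale_row_mx add_row_mx; congr row_mx.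
  by apply/matrixP => i k; rewrite !mxE mulrnAr -mulrnDl.
by apply/rowP => i; rewrite !mxE mulrBr addrACA -opprD.
Qed.
HB.instance Definition _ j m := GRing.isLinear.Build R (aff (E m)) 'rV[R]_(1 + r) _
  (@aff_triv_fun j m) (@aff_triv_linear j m).
Definition aff_triv j m : {linear aff (E m) -> 'rV[R]_(1 + r)} := @aff_triv_fun j m.

Definition aff_inv_fun j m (y : 'rV[R]_(1 + r)) (a : E m) : R^o :=
  lsubmx y 0 0 + \sum_i rsubmx y 0 i * atriv E j m a 0 i.

Lemma aff_inv_linear j m (x : 'rV[R]_r) :
  linear (fun v : V m => \sum_i x 0 i * alin E j m v 0 i : R^o).
Proof.
move=> a u v; rewrite scaler_sumr -big_split/=; apply: eq_bigr => i _.
by rewrite linearP !mxE mulrDr /GRing.scale/= mulrCA.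
Qed.

Lemma aff_inv_proof j m y : @aff_inv_fun j m y \in aff_pred (E := E m).
Proof.
apply/aff_predP; exists (mkdual (@aff_inv_linear j m (rsubmx y))) => a v.
rewrite /aff_inv_fun -addrA; congr (_ + _).
rewrite -[X in _ = _ + X]/(\sum_i rsubmx y 0 i * alin E j m v 0 i) -big_split.
by apply: eq_bigr => i _; rewrite atrivD [X in _ * X = _]mxE mulrDr.
Qed.
Definition aff_inv j m y : aff (E m) := Aff (@aff_inv_proof j m y).

Lemma aff_invE j m y a : @aff_inv j m y a =
  lsubmx y 0 0 + \sum_i rsubmx y 0 i * atriv E j m a 0 i.
Proof. by []. Qed.

Lemma sum_mul_delta (x : 'rV[R]_r) i :
  \sum_k x 0 k * (delta_mx 0 i : 'rV[R]_r) 0 k = x 0 i.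
Proof.
rewrite (bigD1 i)//= mxE !eqxx mulr1 big1 ?addr0// => k ki.
by rewrite mxE (negbTE ki) andbF mulr0.
Qed.

Lemma sum_mul0 (x : 'rV[R]_r) : \sum_k x 0 k * (0 : 'rV[R]_r) 0 k = 0.
Proof. by rewrite big1// => k _; rewrite [X in _ * X]mxE mulr0. Qed.

Lemma aff_invK j m : adom E j m -> cancel (@aff_inv j m) (aff_triv j m).
Proof.
move=> jm y; rewrite -[LHS]/(aff_triv_fun _ _) -[RHS]hsubmxK; congr row_mx.
  apply/rowP => i; rewrite !ord1 [LHS]mxE eqxx mulr1n.
  by rewrite aff_invE ainvK// sum_mul0 addr0.
apply/rowP => i; rewrite [LHS]mxE !aff_invE.
by rewrite !ainvK// sum_mul0 addr0 sum_mul_delta addrC addKr.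
Qed.

Lemma ainvE j m x : adom E j m ->
  exists2 v, ainv E j m x = ainv E j m 0 +: v & alin E j m v = x.
Proof.
move=> jm.
have [v [vE _]] := vadd_simply_transitive (ainv E j m 0) (ainv E j m x).
exists v; first by rewrite vE.
by rewrite -[RHS](ainvK jm) -vE atrivD ainvK// add0r.
Qed.

Lemma alin_inj j m : adom E j m -> injective (alin E j m).
Proof.
move=> jm u v uv; have a := ainv E j m 0.
have /(can_inj (atrivK jm)) E1 : atriv E j m (a +: u) = atriv E j m (a +: v).
  by rewrite !atrivD uv.
have [w [_ wU]] := vadd_simply_transitive a (a +: v).
by rewrite -(wU u)// -(wU v).
Qed.

Lemma aff_trivK j m : adom E j m -> cancel (aff_triv j m) (@aff_inv j m).
Proof.
move=> jm p; apply: aff_eq => a.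
pose o := ainv E j m 0.
have pE i : p (ainv E j m (delta_mx 0 i)) - p o =
    linear_part p (projT1 (cid2 (ainvE (delta_mx 0 i) jm))).
  by case: cid2 => v /= -> _; rewrite linear_partP addrC addKr.
have [v [vE _]] := vadd_simply_transitive o a.
have lv : atriv E j m a = alin E j m v by rewrite -vE atrivD /o ainvK// add0r.
rewrite aff_invE -[aff_triv j m p]/(aff_triv_fun _ _).
rewrite /aff_triv_fun row_mxKl row_mxKr mxE eqxx mulr1n -/o -vE linear_partP.
congr (_ + _); rewrite {1}vE lv.
have {2}-> : v = \sum_i alin E j m v 0 i *:
    projT1 (cid2 (ainvE (delta_mx 0 i) jm)).
  apply: (alin_inj jm); rewrite linear_sum/= {1}[alin E j m v]row_sum_delta.
  by apply: eq_bigr => i _; rewrite linearZ/=; case: cid2 => w /= _ ->.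
rewrite linear_sum/=.
by apply: eq_bigr => i _; rewrite mxE pE linearZ/= mulrC.
Qed.

Lemma aff_transition j k y i : smooth_on (adom E j `&` adom E k)
  (fun m => aff_triv k m (@aff_inv j m y) 0 i).
Proof.
have oU : open (adom E j `&` adom E k) by apply: openI; exact: adom_open.
have Sx x : smooth_on (adom E j `&` adom E k)
    (fun m => aff_inv_fun j y (ainv E k m x)).
  apply: smooth_onD => //; first exact: smooth_on_cst.
  apply: smooth_on_sum => // l; apply: smooth_onZ => //.
  by rewrite setIC; exact: atransition.
rewrite -[i](splitK i); case: (fintype.split i) => l /=.
  rewrite (_ : (fun=> _) = fun m => aff_inv_fun j y (ainv E k m 0)) //.
  by apply/funext => m; rewrite [LHS](row_mxEl _ _ 0 l) !ord1 mxE eqxx mulr1n.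
rewrite (_ : (fun=> _) = fun m =>
  aff_inv_fun j y (ainv E k m (delta_mx 0 l)) - aff_inv_fun j y (ainv E k m 0)).
  exact: smooth_onB.
by apply/funext => m; rewrite [LHS](row_mxEr _ _ 0 l) mxE.
Qed.

Definition aff_bundle : vbundle M (1 + r) :=
  @VBundle R n M (1 + r) (fun m => aff (E m)) (aidx E) (adom E)
    aff_triv aff_inv (adom_open E) (adom_cover E)
    aff_trivK aff_invK aff_transition.

Definition bidual_bundle : vbundle M (1 + r) := dual_bundle aff_bundle.

Lemma one_smooth :
  ((fun m => aff_cst (E m) 1) : pre_section aff_bundle)
    \in section_pred (A := aff_bundle).
Proof.
apply/section_predP => j i; rewrite -[i](splitK i); case: (fintype.split i) => l /=.
  rewrite (_ : (fun=> _) = cst 1); first exact: smooth_on_cst.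
  by apply/funext => m; rewrite [LHS](row_mxEl _ _ 0 l) !ord1 mxE eqxx mulr1n.
rewrite (_ : (fun=> _) = cst 0); first exact: smooth_on_cst.
by apply/funext => m; rewrite [LHS](row_mxEr _ _ 0 l) mxE; exact: subrr.
Qed.
Definition one_section : 'Gamma(aff_bundle) := VSection one_smooth.

End AffFunctions.

(* The anchor is a fibrewise linear map into the tangent spaces; its smoothness
   as a bundle map means that it sends smooth sections to smooth vector fields,
   i.e. that these map smooth functions to smooth functions. That the anchor is
   a morphism of Lie algebras follows from the axioms. *)
Record lie_algebroid (R : realType) (n : nat) (M : manifold R n) (r : nat)
    (A : vbundle M r) := LieAlgebroid {
  anchor : forall m, {linear A m -> tangent m} ;
  bracket : 'Gamma(A) -> 'Gamma(A) -> 'Gamma(A) ;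
  anchor_smooth : forall (s : 'Gamma(A)) (f : 'Coo(M)),
    (fun m => anchor m (s m) f) \in smooth_pred (M := M) ;
  bracket_linear : forall (a : R) s t u,
    bracket (sfun_cst M a *: s + t) u = sfun_cst M a *: bracket s u + bracket t u ;
  bracket_antisym : forall s t, bracket s t = - bracket t s ;
  bracket_jacobi : forall s t u,
    bracket s (bracket t u) + bracket t (bracket u s) + bracket u (bracket s t) = 0 ;
  bracket_leibniz : forall s (f : 'Coo(M)) t,
    bracket s (f *: t) = f *: bracket s t + SFun (anchor_smooth s f) *: t }.

Section Differential.
Variables (R : realType) (n : nat) (M : manifold R n) (r : nat).
Variables (A : vbundle M r) (L : lie_algebroid A).

Definition anchor_act (s : 'Gamma(A)) (f : 'Coo(M)) : 'Coo(M) :=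
  SFun (anchor_smooth L s f).

(* Sections of the second exterior power of the dual of [A], as alternating
   'Coo(M)-bilinear maps on sections of [A]. *)
Record form2 := Form2 {
  form2_val :> 'Gamma(A) -> 'Gamma(A) -> 'Coo(M) ;
  form2_linear : forall (f : 'Coo(M)) s t u,
    form2_val (f *: s + t) u = f * form2_val s u + form2_val t u ;
  form2_antisym : forall s t, form2_val s t = - form2_val t s }.

Lemma form2_0_linear (f : 'Coo(M)) (s t u : 'Gamma(A)) : 0 = f * 0 + 0 :> 'Coo(M).
Proof. by rewrite mulr0 addr0. Qed.
Lemma form2_0_antisym (s t : 'Gamma(A)) : 0 = - 0 :> 'Coo(M).
Proof. by rewrite oppr0. Qed.
Definition form2_0 : form2 :=
  @Form2 (fun _ _ => 0) form2_0_linear form2_0_antisym.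

Definition d1_val (theta : 'Gamma(dual_bundle A)) (s t : 'Gamma(A)) : 'Coo(M) :=
  anchor_act s (pairing theta t) - anchor_act t (pairing theta s)
  - pairing theta (bracket L s t).

Lemma sfun_eq (f g : 'Coo(M)) : (forall m, f m = g m) -> f = g.
Proof. by move=> fg; apply: val_inj; apply/funext => m; exact: fg. Qed.

Lemma d1_antisym theta s t : d1_val theta s t = - d1_val theta t s.
Proof.
rewrite /d1_val bracket_antisym.
have -> : pairing theta (- bracket L t s) = - pairing theta (bracket L t s).
  by apply: sfun_eq => m /=; rewrite -[LHS]/(theta m (- bracket L t s m)) linearN.
by rewrite !opprB opprK addrC addrA.
Qed.

Lemma pairing_linear theta (f : 'Coo(M)) (s t : 'Gamma(A)) :
  pairing theta (f *: s + t) = f * pairing theta s + pairing theta t.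
Proof.
apply: sfun_eq => m; rewrite -[LHS]/(theta m (f m *: s m + t m)).
by rewrite linearP.
Qed.

Lemma anchor_act_linear (f g : 'Coo(M)) (s t : 'Gamma(A)) :
  anchor_act (f *: s + t) g = f * anchor_act s g + anchor_act t g.
Proof.
apply: sfun_eq => m; rewrite -[LHS]/(anchor L m (f m *: s m + t m) g).
by rewrite linearP.
Qed.

Lemma anchor_actD (f g : 'Coo(M)) (s : 'Gamma(A)) :
  anchor_act s (f + g) = anchor_act s f + anchor_act s g.
Proof.
apply: sfun_eq => m.
by have /derivation_predP[/(_ f g)] := tangentP (anchor L m (s m)).
Qed.

Lemma anchor_actM (f g : 'Coo(M)) (s : 'Gamma(A)) :
  anchor_act s (f * g) = f * anchor_act s g + g * anchor_act s f.
Proof.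
apply: sfun_eq => m.
by have /derivation_predP[_ _ /(_ f g)] := tangentP (anchor L m (s m)).
Qed.

Lemma d1_linear theta (f : 'Coo(M)) s t u :
  d1_val theta (f *: s + t) u = f * d1_val theta s u + d1_val theta t u.
Proof.
have brD x y z : bracket L (x + y) z = bracket L x z + bracket L y z.
  have := bracket_linear L 1 x y z.
  have -> : sfun_cst M 1 = 1 by exact: sfun_eq.
  by rewrite !scale1r.
have brZ : bracket L (f *: s) u = f *: bracket L s u - anchor_act u f *: s.
  by rewrite bracket_antisym bracket_leibniz opprD -scalerN -bracket_antisym.
rewrite /d1_val anchor_act_linear pairing_linear anchor_actD anchor_actM.
rewrite brD brZ -(addrA (f *: bracket L s u)) -scaleNr !pairing_linear; apply: sfun_eq => m.
rewrite -[LHS]/(f m * anchor_act s (pairing theta u) m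
    + anchor_act t (pairing theta u) m
  - (f m * anchor_act u (pairing theta s) m + pairing theta s m * anchor_act u f m
    + anchor_act u (pairing theta t) m)
  - (f m * pairing theta (bracket L s u) m
    + (- anchor_act u f m * pairing theta s m + pairing theta (bracket L t u) m))).
rewrite -[RHS]/(f m * (anchor_act s (pairing theta u) m
    - anchor_act u (pairing theta s) m - pairing theta (bracket L s u) m)
  + (anchor_act t (pairing theta u) m
    - anchor_act u (pairing theta t) m - pairing theta (bracket L t u) m)).
by ring.
Qed.

Definition d1 (theta : 'Gamma(dual_bundle A)) : form2 :=
  Form2 (d1_linear theta) (d1_antisym theta).

End Differential.
Arguments form2_0 {R n M r A}.

Section Restriction.
Variables (R : realType) (n : nat) (M : manifold R n) (r : nat).
Variables (V : vbundle M r) (E : affbundle V).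

(* Lying in the image of a bundle map is meant pointwise. *)
Definition in_immersion (s : 'Gamma(bidual_bundle E)) : Prop :=
  forall m, exists a : E m, s m = immersion a.

Definition in_linear_immersion (s : 'Gamma(bidual_bundle E)) : Prop :=
  forall m, exists v : V m, s m = linear_immersion (E m) v.

Definition restricts (L : lie_algebroid (bidual_bundle E)) : Prop :=
  forall s t, in_immersion s -> in_immersion t ->
    in_linear_immersion (bracket L s t).

Definition e0 : 'Gamma(dual_bundle (bidual_bundle E)) :=
  bidual_section (one_section E).

End Restriction.

(* Main.v *)
Require Import Defs.
From mathcomp Require Import all_boot all_order all_algebra.
From mathcomp Require Import all_classical all_reals all_analysis.
From mathcomp Require Import ring lra.
Set Implicit Arguments.
Unset Strict Implicit.
Unset Printing Implicit Defensive.
Import Order.TTheory GRing.Theory Num.Theory.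
Import numFieldNormedType.Exports.
Local Open Scope classical_set_scope.
Local Open Scope ring_scope.

(** The 1-form [e0] evaluates a section of the bidual on the constant function 1;
    a section lies in the image of [i] when this value is 1 and in the image of
    the linear part of [i] when it is 0. If [s] and [t] lie in the image of [i],
    the anchor kills the constants [e0(s)] and [e0(t)], so [de0(s, t)] is
    [- e0([s, t])], and [E] is preserved exactly when [de0] vanishes on pairs of
    sections of [E]. Such pairs span all sections over smooth functions once [E]
    has one global section [c]: then [s = e0(s) c + k] with [e0(k) = 0], and
    [c + k] is again a section of [E].

    A global section is built from bump functions and the Lindelof property:
    there are global sections [S k] of the bidual with [e0(S k) = 1] on open
    sets covering [M], and the sequence [u 0 = 0],
    [u (k+1) = u k + (1 - e0(u k)) S k] is locally eventually constant with
    [e0 = 1], which spares a locally finite refinement. *)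

(** * Flat functions on the real line *)

Section FlatFunction.
Variable R : realType.
Implicit Types (p : {poly R}) (x y : R).

Lemma expr_le_expR i y : 0 <= y -> y ^+ i <= i`!%:R * expR y.
Proof.
case: i => [|i] y0; first by rewrite expr0 fact0 mul1r -expR0 ler_expR.
rewrite mulrC -ler_pdivrMr ?ltr0n ?fact_gt0//.
by apply: le_trans (expR_ge1Dxn i y0); rewrite lerDr.
Qed.

Lemma poly_le_expR p : exists C, forall y, 0 <= y -> `|p.[y]| <= C * expR y.
Proof.
exists (\sum_(i < size p) `|p`_i| * i`!%:R) => y y0.
rewrite horner_coef (le_trans (ler_norm_sum _ _ _))// mulr_suml ler_sum// => i _.
by rewrite normrM [`|_ ^+ _|]ger0_norm ?exprn_ge0// -mulrA ler_wpM2l// expr_le_expR.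
Qed.

(* With [p := 1] this is the classical flat function [exp(-1/x)]; the family
   indexed by [p] is closed under differentiation. *)
Definition flat p x : R := if 0 < x then p.[x^-1] * expR (- x^-1) else 0.

(** Bounding [p * 'X^2] by the exponential at [x^-1] gains the factor [x ^+ 2], which later forces
    the difference quotient at 0 to tend to 0. *)
Lemma flat_le p : exists C, forall x, `|flat p x| <= C * x ^+ 2.
Proof.
have [C Cp] := poly_le_expR (p * 'X^2); exists C => x; rewrite /flat.
have C0 : 0 <= C by have := le_trans (normr_ge0 _) (Cp 0 (lexx 0)); rewrite expR0 mulr1.
case: ltP => x0; last by rewrite normr0 mulr_ge0// sqr_ge0.
have := Cp _ (ltW (etrans (invr_gt0 x) x0)).
rewrite hornerM hornerXn [`|_ * _ ^+ _|]normrM (ger0_norm (sqr_ge0 _)) exprVn.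
rewrite ler_pdivrMr ?exprn_gt0// => Cpx; rewrite normrM [`|expR _|]gtr0_norm ?expR_gt0//.
by rewrite expRN ler_pdivrMr ?expR_gt0// mulrAC.
Qed.

Lemma flat0 p x : x <= 0 -> flat p x = 0.
Proof. by rewrite /flat leNgt => /negbTE->. Qed.

Lemma is_derive_flat p x : is_derive x 1 (flat p) (flat ('X^2 * (p - p^`())) x).
Proof.
have [x0|x0|->] := ltgtP x 0.
- rewrite /flat ltNge (ltW x0)/=.
  apply: (@near_eq_is_derive _ _ _ (cst 0)).
  have : \forall z \near x, z < 0 by exact: lt_nbhsl.
  by apply: filterS => z z0; rewrite ltNge (ltW z0).
- apply: (@near_eq_is_derive _ _ _ (fun x => p.[x^-1] * expR (- x^-1))).
    have : \forall z \near x, 0 < z by exact: lt_nbhsr.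
    by apply: filterS => z z0; rewrite /flat z0.
  rewrite /flat x0 hornerM hornerXn hornerD hornerN.
  have xN0 : x != 0 by rewrite gt_eqF.
  have dV : is_derive x 1 (fun x : R => x^-1) (- x ^- 2 *: 1).
    exact: is_deriveV xN0 (is_derive_id x 1).
  have d1 := is_derive1_comp (is_derive_poly p x^-1) dV.
  have d2 := @is_derive1_comp _ _ (fun x : R => - x^-1) _ _ _
    (is_derive_expR (- x^-1)) (is_deriveN dV).
  apply: is_derive_eq (is_deriveM d1 d2) _ => /=.
  rewrite /GRing.scale/= !mulr1 exprVn; ring.
(* At 0 the difference quotient is at most [C * |h|] in absolute value, so the derivative is 0. *)
- rewrite [X in is_derive _ _ _ X]flat0//.
  have [C Cp] := flat_le p.
  have cv : h^-1 *: ((flat p \o shift 0) (h *: (1 : R)) - flat p 0) @[h --> 0^'] --> (0 : R).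
    apply/cvgr0Pnorm_lt => e e0.
    have C1 : 0 < 1 + `|C| by rewrite ltr_pwDl.
    near=> h.
    have h0 : h != 0 by near: h; exact: nbhs_dnbhs_neq.
    rewrite /= (flat0 p (lexx 0)) subr0 addr0 /GRing.scale/= mulr1 normrM normfV.
    rewrite mulrC ltr_pdivrMr ?normr_gt0// (le_lt_trans (Cp h))//.
    rewrite -(ger0_norm (sqr_ge0 h)) normrX expr2 mulrA ltr_pM2r ?normr_gt0//.
    have : `|h| < e / (1 + `|C|).
      by near: h; apply: dnbhs0_lt; rewrite divr_gt0.
    rewrite ltr_pdivlMr// mulrC; apply: le_lt_trans.
    by rewrite ler_wpM2r// (le_trans (ler_norm C))// lerDr.
  by apply: DeriveDef; [apply/cvg_ex; exists 0|exact/cvg_lim].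
Unshelve. all: by end_near. Qed.

Lemma flat_gt0 x : (0 < flat 1 x) = (0 < x).
Proof.
rewrite /flat; case: (ltP 0 x) => x0; last by rewrite ltxx.
by rewrite hornerC mul1r expR_gt0.
Qed.

End FlatFunction.

(** * A smooth step from 0 to 1, and its composition with smooth functions *)

Section SmoothStep.
Variables (R : realType) (V : normedModType R).
Implicit Types (f : V -> R) (U : set V).

(** The whole sequence of successive derivatives is carried along: the chain rule replaces [G j] by
    [G j.+1], and the induction on [k] holds for all [j]. *)
Lemma Ck_comp (G : nat -> R -> R) k j U f : open U ->
  (forall i (y : R), is_derive y 1 (G i) (G i.+1 y)) ->
  Ck k U f -> Ck k U (G j \o f).
Proof.
move=> oU dG; have diffG i y : differentiable (G i) y.
  by apply/derivable1_diffP; case: (dG i y).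
elim: k j f => [|k IH] j f fC.
  move=> x Ux; apply: continuous_comp; first exact: fC.
  exact: differentiable_continuous.
have [df Df] := fC; split=> [x Ux|v].
  by apply: differentiable_comp; [exact: df|].
apply: (Ck_eq oU) (CkM oU (IH j.+1 f (Ck_pred fC)) (Df v)) => x Ux.
have cd : differentiable (G j \o f) x by apply: differentiable_comp; [exact: df|].
have dfx := df x Ux; rewrite /= [RHS]deriveE// [X in _ * X]deriveE//.
have E w : 'd (G j) (f x) w = w * G j.+1 (f x).
  rewrite -[w in LHS]mulr1 -[w * 1]/(w *: (1 : R)) linearZ/= -deriveE//.
  by rewrite (derive_val (is_derive := dG j (f x))).
have -> : 'd (G j \o f) x v = 'd (G j) (f x) ('d f x v) by rewrite diff_comp.
by rewrite E mulrC.
Qed.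

Lemma CkV k U f : open U -> (forall x, U x -> f x != 0) -> Ck k U f ->
  Ck k U (fun x => (f x)^-1).
Proof.
move=> oU f0; elim: k => [|k IH] fC.
  by move=> x Ux; apply: cvgV; [exact: f0|exact: fC].
have [df Df] := fC; have VC := IH (Ck_pred fC); split=> [x Ux|v].
  by apply: differentiableV; [exact: df|exact: f0].
have := CkM oU (CkM oU VC VC) (CkM oU (@Ck_cst _ _ k U (-1)) (Df v)).
apply: (Ck_eq oU) => x Ux /=.
rewrite deriveV; [|exact: f0|by apply: diff_derivable; exact: df].
by rewrite /GRing.scale/= mulrA mulrN1 -exprVn expr2.
Qed.

Definition smoothstep (x : R) : R := flat 1 x / (flat 1 x + flat 1 (1 - x)).

Lemma smoothstep1 x : 1 <= x -> smoothstep x = 1.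
Proof.
move=> x1; rewrite /smoothstep [flat 1 (1 - x)]flat0 ?subr_le0// addr0 divff//.
by rewrite gt_eqF// flat_gt0 (lt_le_trans ltr01).
Qed.

Lemma smoothstep0 x : x <= 0 -> smoothstep x = 0.
Proof. by move=> x0; rewrite /smoothstep flat0// mul0r. Qed.

Lemma Ck_smoothstep k U f : open U -> Ck k U f -> Ck k U (smoothstep \o f).
Proof.
(* The [i]-th derivative of [flat 1] is [flat (q i)]. *)
move=> oU fC; pose q i : {poly R} := iter i (fun p => 'X^2 * (p - p^`())) 1.
have Fl g : Ck k U g -> Ck k U (flat 1 \o g).
  move=> gC; apply: (@Ck_comp (fun i => flat (q i)) k 0%N) => // i y.
  exact: is_derive_flat.
have sC : Ck k U (fun x => 1 - f x).
  have NC := CkM oU (@Ck_cst _ _ k U (-1)) fC.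
  by apply: (Ck_eq oU _ (CkD oU (@Ck_cst _ _ k U 1) NC)) => x _ /=; rewrite mulN1r.
have DC := CkD oU (Fl _ fC) (Fl _ sC).
apply: CkM => //; first exact: Fl.
apply: CkV DC => // x _ /=.
have ge0 y : 0 <= flat 1 y :> R.
  by have [y0|y0] := ltP 0 y; [rewrite ltW// flat_gt0|rewrite flat0].
(* Either [f x] or [1 - f x] is positive, hence so is the denominator. *)
have [x0|x0] := ltP 0 (f x); rewrite gt_eqF//.
  by rewrite ltr_pwDl// flat_gt0.
by rewrite ltr_wpDl// flat_gt0 subr_gt0 (le_lt_trans x0).
Qed.

End SmoothStep.

(** * Bump functions on a manifold, and countable subcovers *)

Section Bump.
Variables (R : realType) (n : nat) (M : manifold R n).
Implicit Types (U : set M).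

Lemma smooth_on_prod U (I : Type) (s : seq I) (F : I -> M -> R) : open U ->
  (forall i, smooth_on U (F i)) -> smooth_on U (fun m => \prod_(i <- s) F i m).
Proof.
move=> oU UF; elim: s => [|i s IH].
  rewrite (_ : (fun=> _) = cst 1); first exact: smooth_on_cst.
  by apply/funext => m; rewrite big_nil.
rewrite (_ : (fun=> _) = (fun m => F i m * \prod_(j <- s) F j m)).
  exact: smooth_onM.
by apply/funext => m; rewrite big_cons.
Qed.

Lemma smooth_on_smoothstep U f : open U -> smooth_on U f ->
  smooth_on U (fun m => smoothstep (f m)).
Proof.
move=> oU Uf c k; apply: Ck_smoothstep (Uf c k).
exact: open_chart_preimage.
Qed.

Lemma smooth_on_chart (c : mchart M) i :
  smooth_on (mdom c) (fun m => mphi c m 0 i).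
Proof. by move=> d; exact: mtransition. Qed.

(** A product of smooth steps in chart coordinates is extended by 0. The closed set [K] is part of
    the conclusion so that objects defined only on [U] can be multiplied by [f] and extended by 0 in
    turn. *)
Lemma bump_exists (m : M) U : open U -> U m ->
  exists (f : 'Coo(M)) (K : set M), [/\ closed K, K `<=` U,
    (\forall x \near m, f x = 1) & forall x, ~ K x -> f x = 0].
Proof.
move=> oU Um; have [c cm] := mdom_cover m; pose x0 := mphi c m.
have : nbhs x0 (mcod c `&` mpsi c @^-1` U).
  apply: open_nbhs_nbhs; split; first exact: open_chart_preimage.
  by split; [exact: mphi_cod|rewrite /= mphiK].
(* With [e = 3 d], the closed box of half-width [2 d] lies in the open ball of radius [e]. *)
move=> /nbhs_ballP[e /= e0 eU]; pose d := e / 3.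
have d0 : 0 < d by rewrite divr_gt0.
pose I i := `[x0 0 i - d *+ 2, x0 0 i + d *+ 2]%classic.
pose B := [set y : 'rV[R]_n | forall i, I i (y 0 i)].
have Be : B `<=` ball x0 e.
  move=> y yB; split=> // i j; rewrite ord1; have := yB j.
  rewrite /I /= in_itv/= /ball/= distrC ltr_distl mulr2n /d => /andP[? ?].
  by apply/andP; split; lra.
have Bc : compact B by apply: (@rV_compact R n I) => i; exact: segment_compact.
pose K := mpsi c @` B.
(* The Hausdorff property enters here: [K] is the continuous image of a compact box. *)
have Kc : closed K.
  apply: compact_closed; first exact: mhausdorff.
  apply: continuous_compact Bc; apply: continuous_in_subspaceT => y /set_mem yB.
  by apply: mpsi_cont; have [] := eU _ (Be _ yB).
(* Each factor is 1 at coordinate distance at most [d] and 0 at distance at least [2 d]. *)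
pose g (x : M) := \prod_i smoothstep (2 - ((mphi c x 0 i - x0 0 i) / d) ^+ 2).
pose f (x : M) := if `[< mdom c x >] then g x else 0.
have fK x : ~ K x -> f x = 0.
  move=> nKx; rewrite /f; case: asboolP => // cx.
  have [i ni] : exists i, ~ I i (mphi c x 0 i).
    apply/existsNP => xB; apply: nKx; exists (mphi c x) => //; exact: mphiK.
  rewrite /g (bigD1 i)//= smoothstep0 ?mul0r// subr_le0.
  move: ni; rewrite /I /= in_itv/= => /negP.
  rewrite -ler_distl -ltNge => di.
  rewrite -real_normK ?num_real// normrM normfV (gtr0_norm d0).
  rewrite (@le_trans _ _ (2 ^+ 2))//; first by rewrite expr2; lra.
  rewrite ler_sqr ?nnegrE ?divr_ge0 ?(ltW d0) ?(ltW e0)//.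
  by rewrite ler_pdivlMr// mulr_natl ltW.
have fS : smooth_on setT f.
  (* The chart domain and the complement of [K] are open and cover [M]; [f] is [g] on the first and
     0 on the second. *)
  apply: (@smooth_on_glue _ _ _ bool (fun b => if b then mdom c else ~` K)).
    move=> x _; have [Kx|nKx] := pselect (K x); last by exists false.
    by exists true; case: Kx => y yB <-; apply: mpsi_dom; have [] := eU _ (Be _ yB).
  case; last first.
    apply: (@smooth_on_eq _ _ _ _ (cst 0)); [exact: closed_openC| |exact: smooth_on_cst].
    by move=> x /fK.
  have oc : open (mdom c) by exact: mdom_open.
  apply: (@smooth_on_eq _ _ _ _ g) => //.
    by move=> x cx; rewrite /f; case: asboolP.
  apply: smooth_on_prod => // i; apply: smooth_on_smoothstep => //.
  apply: smooth_onB => //; first exact: smooth_on_cst.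
  have : smooth_on (mdom c) (fun x => (mphi c x 0 i - x0 0 i) / d).
    apply: smooth_onM => //; last exact: smooth_on_cst.
    apply: smooth_onB => //; [exact: smooth_on_chart|exact: smooth_on_cst].
  by move=> s; apply: smooth_onM.
exists (SFun ((smooth_predP f).2 fS)), K; split => //.
- by move=> _ [y yB <-]; have [] := eU _ (Be _ yB).
- have cm' : nbhs m (mdom c) by apply: open_nbhs_nbhs; split => //; exact: mdom_open.
  have xm' : \forall x \near m, ball x0 d (mphi c x).
    by apply: (mphi_cont cm); exact: nbhsx_ballx.
  apply: filterS2 cm' xm' => x cx xd; rewrite /= /f; case: asboolP => // _.
  rewrite /g big1// => i _; rewrite smoothstep1// lerBrDr -lerBrDl.
  rewrite (_ : 2 - 1 = 1); last by ring.
  rewrite -real_normK ?num_real// expr_le1// normrM normfV (gtr0_norm d0).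
  by rewrite ler_pdivrMr// mul1r distrC ltW//; exact: (xd.2 0 i).
Qed.

End Bump.

Lemma lindelof (T : topologicalType) (A : Type) (P : A -> T -> Prop) :
  @second_countable T -> A -> (forall x : T, exists a, \forall y \near x, P a y) ->
  exists s : nat -> A, forall x : T, exists k, \forall y \near x, P (s k) y.
Proof.
move=> [B /countable_injP[c cI] [oB bB]] a0 cov.
(* [s k] is chosen for the unique basic set of code [k], when there is one and it fits into some
   [P a]; [a0] is the default. *)
have /choice[s sP] : forall k, exists a, forall b, B b -> c b = k ->
    (exists a', b `<=` P a') -> b `<=` P a.
  move=> k; have [[b [Bb cb [a ba]]]|nb] :=
      pselect (exists b, [/\ B b, c b = k & exists a, b `<=` P a]).
    exists a => b' Bb' cb' _; suff -> : b' = b by [].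
    by apply: cI; rewrite ?inE// cb cb'.
  by exists a0 => b Bb cb [a ba]; case: nb; exists b; split => //; exists a.
exists s => x; have [a Pa] := cov x.
have [b [Bb bx] bP] := bB x _ Pa; exists (c b).
apply: filterS (open_nbhs_nbhs (conj (oB _ Bb) bx)) => y.
by apply: sP => //; exists a.
Qed.

(** * Images of the immersion and of its linear part as level sets of [e0]; local sections *)

Section BidualFibre.
Variables (R : realType) (n : nat) (M : manifold R n) (r : nat).
Variables (V : vbundle M r) (E : affbundle V).

Definition aff_coord j (m : M) i : aff (E m) :=
  aff_inv j m (delta_mx 0 (rshift 1 i)).

Lemma aff_coordE j m i a : aff_coord j m i a = atriv E j m a 0 i.
Proof.
rewrite /aff_coord aff_invE mxE mxE eq_lrshift andbF add0r.
rewrite (bigD1 i)//= big1 ?addr0 => [|k ki].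
  by rewrite !mxE !eqxx mul1r.
by rewrite !mxE eq_rshift (negbTE ki) mul0r.
Qed.

Lemma aff_inv_expand j m (y : 'rV[R]_(1 + r)) :
  aff_inv j m y = lsubmx y 0 0 *: aff_cst (E m) 1
    + \sum_i rsubmx y 0 i *: aff_coord j m i.
Proof.
apply: aff_eq => a; rewrite aff_invE -[RHS]/(immersion a _) linearP linear_sum.
congr (_ + _); first exact/esym/mulr1.
by apply: eq_bigr => i _; rewrite linearZ -aff_coordE.
Qed.

Lemma immersion_of_one m (l : dual (aff (E m))) :
  l (aff_cst (E m) 1) = 1 -> exists a, l = immersion a.
Proof.
move=> l1; have [j jm] := adom_cover E m.
(* The point whose coordinates are the values of [l] on the coordinate functions. These functions
   and the constant 1 span all affine functions on the fibre. *)
exists (ainv E j m (\row_i l (aff_coord j m i))); apply: dual_eq => p.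
rewrite -(aff_trivK jm p) aff_inv_expand !linearP !linear_sum.
congr (_ * _ + _); first exact: l1.
apply: eq_bigr => i _; rewrite !linearZ.
by congr (_ * _); rewrite -[RHS]/(aff_coord j m i _) aff_coordE ainvK// [RHS]mxE.
Qed.

Lemma immersionD m (a : E m) v :
  immersion (a +: v) = immersion a + linear_immersion (E m) v.
Proof. by apply: dual_eq => p; exact: linear_partP. Qed.

(** Adding the image of a point [b] reduces to value 1; the vector is then the difference of two
    points. *)
Lemma linear_immersion_of_zero m (l : dual (aff (E m))) :
  l (aff_cst (E m) 1) = 0 -> exists v, l = linear_immersion (E m) v.
Proof.
move=> l0; have [b] := apoint_inhabited (E m).
have [a la] : exists a, l + immersion b = immersion a.
  apply: immersion_of_one.
  by rewrite -[LHS]/(l (aff_cst (E m) 1) + 1) l0 add0r.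
have [v [va _]] := vadd_simply_transitive b a; exists v.
by apply: (addIr (immersion b)); rewrite la -va immersionD addrC.
Qed.

Lemma linear_immersion_one m v : linear_immersion (E m) v (aff_cst (E m) 1) = 0.
Proof.
have [b] := apoint_inhabited (E m).
have := linear_partP (aff_cst (E m) 1) b v.
by move=> /= /eqP; rewrite -subr_eq0 opprD addNKr oppr_eq0 => /eqP.
Qed.

Local Notation "''e0' ( s )" := (pairing (e0 E) s).

Lemma e0E (s : 'Gamma(bidual_bundle E)) m :
  'e0(s) m = s m (aff_cst (E m) 1).
Proof. by []. Qed.

Lemma in_immersionP (s : 'Gamma(bidual_bundle E)) :
  in_immersion s <-> 'e0(s) = 1.
Proof.
split=> [si|s1 m].
  by apply: sfun_eq => m; rewrite e0E; have [a ->] := si m.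
by apply: immersion_of_one; rewrite -e0E s1.
Qed.

Lemma in_linear_immersionP (s : 'Gamma(bidual_bundle E)) :
  in_linear_immersion s <-> 'e0(s) = 0.
Proof.
split=> [si|s1 m].
  by apply: sfun_eq => m; rewrite e0E; have [v ->] := si m; exact: linear_immersion_one.
by apply: linear_immersion_of_zero; rewrite -e0E s1.
Qed.

(** Coordinates in the dual bundle are values on the basis affine functions of trivialization [k],
    here taken at the origin of trivialization [j]. *)
Lemma immersion_ainv_smooth j k i : smooth_on (adom E j `&` adom E k) (fun m =>
  vtriv (bidual_bundle E) k m (immersion (ainv E j m 0)) 0 i).
Proof.
have oU : open (adom E j `&` adom E k) by apply: openI; exact: adom_open.
rewrite (_ : (fun=> _) = fun m => lsubmx (delta_mx 0 i : 'rV[R]_(1 + r)) 0 0 +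
    \sum_l rsubmx (delta_mx 0 i : 'rV[R]_(1 + r)) 0 l * atriv E k m (ainv E j m 0) 0 l).
  apply: smooth_onD => //; first exact: smooth_on_cst.
  apply: smooth_on_sum => // l; apply: smooth_onZ => //; exact: atransition.
by apply/funext => m; rewrite [LHS]mxE.
Qed.

Lemma local_immersion (m : M) : exists s : 'Gamma(bidual_bundle E),
  \forall x \near m, 'e0(s) x = 1.
Proof.
have [j jm] := adom_cover E m.
have [f [K [Kc Kj f1 f0]]] := bump_exists (adom_open E j) jm.
(* Outside [adom E j] the value of [ainv] is meaningless, but [f] vanishes there. On [adom E j],
   [e0(s) = f]. *)
pose s : pre_section (bidual_bundle E) := fun x => f x *: immersion (ainv E j x 0).
have sS : smooth_section s.
  move=> k i; have ok : open (adom E k) by exact: adom_open.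
  apply: (@smooth_on_glue _ _ _ bool (fun b =>
    if b then adom E j `&` adom E k else ~` K)).
    move=> x kx; have [Kx|nKx] := pselect (K x); last by exists false.
    by exists true; split => //; exact: Kj.
  case; last first.
    apply: (@smooth_on_eq _ _ _ _ (cst 0)); [exact: closed_openC| |exact: smooth_on_cst].
    by move=> x /f0 fx; rewrite /s fx scale0r linear0 mxE.
  have oU : open (adom E j `&` adom E k) by apply: openI; exact: adom_open.
  rewrite (_ : (fun=> _) = fun x => f x *
      vtriv (bidual_bundle E) k x (immersion (ainv E j x 0)) 0 i).
    apply: smooth_onM => //; last exact: immersion_ainv_smooth.
    by apply: (@smooth_on_sub _ _ _ setT) => //; apply/smooth_predP; exact: sfunP.
  by apply/funext => x; rewrite /s linearZ mxE.
exists (VSection ((section_predP s).2 sS)).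
by apply: filterS f1 => x fx; rewrite e0E /= /s fx scale1r.
Qed.

End BidualFibre.

(** * Gluing a global section of [E] inside the bidual *)

Lemma locally_section (R : realType) (n : nat) (M : manifold R n) (r : nat)
    (A : vbundle M r) (s : pre_section A) :
  (forall m : M, exists t : 'Gamma(A), \forall x \near m, s x = t x) ->
  smooth_section s.
Proof.
move=> st j i; have oj : open (vdom A j) by exact: vdom_open.
have /choice[t tP] := st.
pose W m := vdom A j `&` interior [set x | s x = t m x].
apply: (@smooth_on_glue _ _ _ M W) => [m jm|m].
  by exists m; split => //; exact: tP.
have oW : open (W m) by apply: openI => //; exact: open_interior.
apply: (@smooth_on_eq _ _ _ _ (fun x => vtriv A j x (t m x) 0 i)) => //.
  by move=> x [_ /interior_subset ->].
apply: (@smooth_on_sub _ _ _ (vdom A j)); first exact: subIsetl.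
by have /section_predP := sectionP (t m); apply.
Qed.

Section GlobalSection.
Variables (R : realType) (n : nat) (M : manifold R n) (r : nat).
Variables (V : vbundle M r) (E : affbundle V).
Local Notation "''e0' ( s )" := (pairing (e0 E) s).

Lemma immersion_section_exists :
  exists s : 'Gamma(bidual_bundle E), 'e0(s) = 1.
Proof.
have [S SP] := lindelof (@msecond_countable _ _ M) 0 (local_immersion E).
pose u := fix u k := if k is l.+1 then u l + (1 - 'e0(u l)) *: S l else 0.
have uS k m : u k.+1 m = u k m + (1 - 'e0(u k) m) *: S k m by [].
have u1 k m : 'e0(S k) m = 1 -> 'e0(u k.+1) m = 1.
  move=> Sk; rewrite e0E uS.
  rewrite -[LHS]/(u k m (aff_cst (E m) 1) + (1 - 'e0(u k) m) * 'e0(S k) m).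
  by rewrite Sk mulr1 e0E addrC subrK.
(* Once [e0(u l)] is 1 at [m], every later correction vanishes there. *)
have stab k l m : 'e0(S k) m = 1 -> (k < l)%N -> u l m = u k.+1 m.
  move=> Sk; elim: l => // l IH; rewrite ltnS leq_eqVlt => /predU1P[->//|kl].
  have e1 : 'e0(u l) m = 1 by rewrite e0E IH// -e0E; exact: u1.
  by rewrite uS e1 subrr scale0r addr0 IH.
have /choice[K KP] := SP.
have SK m : 'e0(S (K m)) m = 1 by exact: nbhs_singleton (KP m).
pose s : pre_section (bidual_bundle E) := fun m => u (K m).+1 m.
have sS : smooth_section s.
  apply: locally_section => m; exists (u (K m).+1).
  apply: filterS (KP m) => x Sx; rewrite /s.
  (* At [x] the sequence is stable after both [K x] and [K m], so the two values are compared at a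
     common later index. *)
  have lx : (K x < maxn (K x).+1 (K m).+1)%N by exact: leq_maxl.
  have lm : (K m < maxn (K x).+1 (K m).+1)%N by exact: leq_maxr.
  by rewrite -(stab _ _ _ (SK x) lx) (stab _ _ _ Sx lm).
exists (VSection ((section_predP s).2 sS)).
by apply: sfun_eq => m; rewrite e0E; exact: u1.
Qed.

End GlobalSection.

(** * Values of 2-forms on sections where a 1-form equals 1 *)

Section AnchorConstant.
Variables (R : realType) (n : nat) (M : manifold R n) (r : nat).
Variables (A : vbundle M r) (L : lie_algebroid A).

(** The Leibniz rule on [1 * 1] gives [D 1 = D 1 + D 1]. *)
Lemma anchor_act1 s : anchor_act L s 1 = 0.
Proof.
have := anchor_actM L 1 1 s; rewrite !mul1r => /eqP.
by rewrite addrC -subr_eq subrr eq_sym => /eqP.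
Qed.

Lemma d1_of_pairing1 theta s t : pairing theta s = 1 -> pairing theta t = 1 ->
  d1 L theta s t = - pairing theta (bracket L s t).
Proof. by move=> s1 t1; rewrite /= /d1_val s1 t1 !anchor_act1 subrr sub0r. Qed.

Lemma form2P (w w' : form2 A) : (forall s t, w s t = w' s t) -> w = w'.
Proof.
case: w w' => [w wL wA] [w' wL' wA'] /= ww'.
have E : w = w' by apply/funext => s; apply/funext => t.
by case: w' / E wL' wA' ww' => wL' wA' _; congr Form2; exact: Prop_irrelevance.
Qed.

End AnchorConstant.

Lemma form2_eq0 (R : realType) (n : nat) (M : manifold R n) (r : nat)
    (A : vbundle M r) (theta : 'Gamma(dual_bundle A)) (w : form2 A) :
  (exists s, pairing theta s = 1) ->
  (forall s t, pairing theta s = 1 -> pairing theta t = 1 -> w s t = 0) ->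
  w = form2_0.
Proof.
move=> [c c1] w1; apply: form2P => s t.
have wD x y z : w (x + y) z = w x z + w y z.
  by have := form2_linear w 1 x y z; rewrite scale1r mul1r.
have wC x y z : w z (x + y) = w z x + w z y.
  by rewrite form2_antisym wD opprD -!form2_antisym.
(* Every section splits into a multiple of [c] and a section killed by [theta]. *)
have pK x : pairing theta (x - pairing theta x *: c) = 0.
  by rewrite addrC -scaleNr pairing_linear c1 mulr1 addNr.
have p1 k : pairing theta k = 0 -> pairing theta (c + k) = 1.
  by move=> k0; rewrite -[c]scale1r pairing_linear c1 k0 mul1r addr0.
have wcc : w c c = 0 by exact: w1.
have wck k : pairing theta k = 0 -> w c k = 0.
  by move=> k0; have := w1 c _ c1 (p1 k k0); rewrite wC wcc add0r.
(* In the expansion of [w (c + k) (c + l) = 0], all terms but [w k l] are already known to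
   vanish. *)
have wkk k l : pairing theta k = 0 -> pairing theta l = 0 -> w k l = 0.
  move=> k0 l0; have := w1 _ _ (p1 k k0) (p1 l l0).
  rewrite wD !wC wcc (wck _ l0) [w k c]form2_antisym (wck _ k0).
  by rewrite oppr0 !add0r.
have w0 y : w 0 y = 0 by apply: (addrI (w 0 y)); rewrite -wD !addr0.
have wZ f x y : w (f *: x) y = f * w x y.
  by have := form2_linear w f x 0 y; rewrite w0 !addr0.
have wcZ f x : w x c = 0 -> w x (f *: c) = 0.
  by move=> xc; rewrite form2_antisym wZ form2_antisym xc oppr0 mulr0 oppr0.
have wcr x : w c x = 0.
  by rewrite -[x](subrK (pairing theta x *: c)) wC wck// add0r wcZ.
rewrite -[s](subrK (pairing theta s *: c)) wD wZ wcr mulr0 addr0.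
rewrite -[t](subrK (pairing theta t *: c)) wC wkk// add0r wcZ//.
by rewrite form2_antisym wcr oppr0.
Qed.

(** * Restriction to [E] as closedness of [e0] *)

Theorem theorem3 (R : realType) (n : nat) (M : manifold R n) (r : nat)
    (V : vbundle M r) (E : affbundle V) (L : lie_algebroid (bidual_bundle E)) :
  restricts L <-> d1 L (e0 E) = form2_0.
Proof.
split=> [Lr|d0 s t].
  apply: form2_eq0 (immersion_section_exists E) _ => s t s1 t1.
  rewrite d1_of_pairing1// (in_linear_immersionP _).1 ?oppr0//.
  by apply: Lr; apply/in_immersionP.
move=> /in_immersionP s1 /in_immersionP t1; apply/in_linear_immersionP.
by apply: oppr_inj; rewrite -d1_of_pairing1// d0 oppr0.
Qed.
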